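(* (i) Consider a controlled Markov chain with finite state space $\mathbb{X}$, finite action space $\mathbb{U}$, and transition kernel $\mathcal{T}(\cdot|x,u)$, such that for every stationary policy there is a unique invariant probability measure. Then the map $\gamma\mapsto\pi_\gamma$ from stationary policies to their invariant probability measures is continuous when the stationary policies are endowed with the Young topology at any input measure on $\mathbb{X}$ that assigns positive mass to each element of $\mathbb{X}$. (ii) The same conclusion holds when $\mathbb{X}$ is countable and $\mathbb{U}$ is compact, every stationary policy has a unique invariant probability measure, the set $\mathcal{G}$ of invariant occupation measures is compact (in the weak topology), and the transition kernel is continuous in the action, i.e. $u\mapsto\mathcal{T}(\cdot|x,u)$ is continuous for each $x$.
   Context: A stationary policy $\gamma$ is a stochastic kernel $\gamma(du|x)$ from $\mathbb{X}$ to $\mathbb{U}$; its invariant probability measure $\pi_\gamma$ satisfies $\pi_\gamma(A)=\sum_{x}\pi_\gamma(x)\int\mathcal{T}(A|x,u)\gamma(du|x)$. $\mathcal{G}=\{\mu\in\mathcal{P}(\mathbb{X}\times\mathbb{U}):\mu(B\times\mathbb{U})=\int\mu(dx,du)\mathcal{T}(B|x,u)\ \forall B\}$. Young topology at input $\mu$: $\gamma_n\to\gamma$ if for every bounded continuous $g$ on $\mathbb{X}\times\mathbb{U}$, $\int\mu(dx)\int\gamma_n(du|x)g(x,u)\to\int\mu(dx)\int\gamma(du|x)g(x,u)$. Continuity of $\gamma\mapsto\pi_\gamma$ is with respect to weak convergence of probability measures on $\mathbb{X}$. *)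

(* Defs.v *)
From HB Require Import structures.
From mathcomp Require Import all_boot all_order all_algebra.
From mathcomp Require Import all_classical all_reals all_analysis.
From Stdlib Require List.
Set Implicit Arguments. Unset Strict Implicit. Unset Printing Implicit Defensive.
Import Order.TTheory GRing.Theory Num.Theory.
Import numFieldNormedType.Exports.
Local Open Scope classical_set_scope.
Local Open Scope ring_scope.

Definition Borel (T : ptopologicalType) := g_sigma_algebraType (@open T).

Section ControlledMC.
Variables (R : realType) (X U : ptopologicalType).

Definition TKernel := R.-pker (Borel X * Borel U)%type ~> Borel X.
Definition Policy := R.-pker (Borel X) ~> Borel U.

Definition bounded_continuous {S : topologicalType} (g : S -> R) : Prop :=
  (exists M : R, forall z, `|g z| <= M) /\ continuous g.

Definition invariant (T : TKernel) (gamma : Policy)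
    (pi : probability (Borel X) R) : Prop :=
  forall A : set (Borel X), measurable A ->
    pi A = (\esum_(x in [set: Borel X])
              (pi [set x] * \int[gamma x]_u T (x, u) A))%E.

Definition unique_invariant (T : TKernel) : Prop :=
  forall gamma : Policy, exists pi : probability (Borel X) R,
    invariant T gamma pi /\
    forall pi' : probability (Borel X) R, invariant T gamma pi' ->
      forall A : set (Borel X), measurable A -> pi' A = pi A.

Definition young_cvg (mu : probability (Borel X) R)
    (gamma_n : nat -> Policy) (gamma : Policy) : Prop :=
  forall g : X * U -> R, bounded_continuous g ->
    (fun n => \int[mu]_x \int[gamma_n n x]_u (g (x, u))%:E)%E @ \oo -->
      (\int[mu]_x \int[gamma x]_u (g (x, u))%:E)%E.

Definition weak_cvg (pi_n : nat -> probability (Borel X) R)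
    (pi : probability (Borel X) R) : Prop :=
  forall f : X -> R, bounded_continuous f ->
    (fun n => \int[pi_n n]_x (f x)%:E)%E @ \oo --> (\int[pi]_x (f x)%:E)%E.

Definition invariant_map_continuous (T : TKernel)
    (mu : probability (Borel X) R) : Prop :=
  forall (gamma_n : nat -> Policy) (gamma : Policy)
         (pi_n : nat -> probability (Borel X) R) (pi : probability (Borel X) R),
    (forall n, invariant T (gamma_n n) (pi_n n)) -> invariant T gamma pi ->
    young_cvg mu gamma_n gamma -> weak_cvg pi_n pi.

Definition occupation_set (T : TKernel) :
    set (probability (Borel X * Borel U)%type R) :=
  [set nu | forall B : set (Borel X), measurable B ->
     nu (B `*` [set: Borel U]) = (\int[nu]_z T z B)%E].

(* Open sets of the weak topology on probability measures on X x U: a basic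
   neighbourhood of nu is given by finitely many bounded continuous test
   functions and a radius e > 0. *)
Definition weak_open (O : set (probability (Borel X * Borel U)%type R)) : Prop :=
  forall nu, O nu -> exists (gs : seq (X * U -> R)) (e : R),
    (forall g, Stdlib.Lists.List.In g gs -> bounded_continuous g) /\ 0 < e /\
    forall nu' : probability (Borel X * Borel U)%type R, (forall g, Stdlib.Lists.List.In g gs ->
        `| fine (integral nu' setT (fun z : (Borel X * Borel U)%type => (g z)%:E)) -
          fine (integral nu setT (fun z : (Borel X * Borel U)%type => (g z)%:E)) | < e) ->
      O nu'.

Definition weak_compact (G : set (probability (Borel X * Borel U)%type R)) : Prop :=
  forall (I : Type) (O : I -> set (probability (Borel X * Borel U)%type R)),
    (forall i, weak_open (O i)) ->
    (forall nu, G nu -> exists i, O i nu) ->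
    exists s : seq I, forall nu, G nu -> exists i, Stdlib.Lists.List.In i s /\ O i nu.

Definition kernel_continuous_in_action (T : TKernel) : Prop :=
  forall (x : X) (f : X -> R), bounded_continuous f ->
    continuous (fun u : U => fine (\int[T (x, u)]_y (f y)%:E)%E).

End ControlledMC.

(* Main.v *)
(* Suppose [gamma_n] converges to [gamma] in the Young topology.  Since the input
   measure charges every state, integrals of continuous functions against
   [gamma_n x] converge for each fixed state [x].  Along an ultrafilter finer
   than [\oo] the invariant measures [pi_n] have a limit [pi']: for finite [X] by
   compactness of [0, 1], in general as the state marginal of a cluster point
   [nu] of the occupation measures [pi_n(dx) gamma_n(du|x)], which lie in the
   compact set of invariant occupation measures.  Test functions supported on one
   fiber {x} x U only see the product of the masses [pi_n {x}] with the integrals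
   against [gamma_n x], so in the limit they integrate under [nu] as they do under
   [pi'(dx) gamma(du|x)], even though [U] need not be Hausdorff and the two
   measures might differ.  As [T(A|x, .)] is continuous, this suffices to turn the
   occupation identity for [nu] into invariance of [pi'] under [gamma]; hence
   [pi'] agrees with the unique invariant measure, and all ultrafilter limits
   coincide. *)

Require Import Defs.
From HB Require Import structures.
From mathcomp Require Import all_boot all_order all_algebra.
From mathcomp Require Import all_classical all_reals all_analysis.
From mathcomp Require Import measurable_realfun.
Import Order.TTheory GRing.Theory Num.Theory.
Import numFieldNormedType.Exports.
Local Open Scope classical_set_scope.
Local Open Scope ring_scope.

(** * Limits along ultrafilters *)

(** If the preimage of some neighbourhood were not in [F], then [F] traced on the complement of that
    preimage would be proper, and an ultrafilter refining it would contradict the hypothesis. *)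
Lemma cvg_ultra {T : Type} {S : topologicalType} (F : set_system T) (u : T -> S)
    (l : S) : Filter F ->
  (forall G : set_system T, UltraFilter G -> F `<=` G -> u @ G --> l) ->
  u @ F --> l.
Proof.
move=> FF FG A Al; apply: contrapT => nFA.
have WP : ProperFilter (within (~` (u @^-1` A)) F).
  split; last exact: (@within_filter _ _ F FF).
  by rewrite /within /= => F0; apply: nFA; apply: filterS F0 => x /= /contrapT.
have [G [GU WG]] := @ultraFilterLemma _ _ WP.
have GA : G (u @^-1` A).
  apply: (FG G GU _ _ Al) => B FB; apply: WG.
  exact: (@cvg_within _ F FF _ B FB).
have GnA : G (~` (u @^-1` A)) by apply: WG; exact: (withinT _ FF).
by have [x []] := filter_ex (filterI GA GnA).
Qed.

(** If the first set is not in [F], its complement is, and the induction goes on with the remaining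
    sets. *)
Lemma ultra_bigcup {T I : Type} {F : set_system T} (A : I -> set T) (s : seq I) :
  UltraFilter F -> F [set x | exists i, List.In i s /\ A i x] ->
  exists i, F (A i).
Proof.
move=> FU; elim: s => [/filter_ex[x [i []]]//|j s IHs] Fs.
have [?|FnA] := in_ultra_setVsetC (A j) FU; first by exists j.
apply: IHs; apply: filterS (filterI Fs FnA) => x [[i [[<-|si] Aix]] nAjx] //.
by exists i.
Qed.

(** * Measurability and integration on discrete state spaces *)

Lemma discrete_continuous {X : discreteTopologicalType} {S : topologicalType}
  (f : X -> S) : continuous f.
Proof.
move=> x A /nbhs_singleton Afx; apply: filterS (discrete_set1 x) => y ->.
exact: Afx.
Qed.

Lemma measurable_discrete {X : pdiscreteTopologicalType} (A : set (Borel X)) :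
  measurable A.
Proof. by apply: sub_sigma_algebra; exact: discrete_open. Qed.

Lemma measurable_fun_discrete {X : pdiscreteTopologicalType} {d}
  {S : measurableType d} (D : set (Borel X)) (f : Borel X -> S) :
  measurable_fun D f.
Proof. by move=> mD B _; exact: measurable_discrete. Qed.

Lemma integral_fibers {R : realType} {X : pdiscreteTopologicalType} {d}
    {S : measurableType d} (m : {measure set S -> \bar R}) (p : S -> Borel X)
    (h : S -> \bar R) :
  countable [set: X] -> measurable_fun setT p -> measurable_fun setT h ->
  (forall z, 0 <= h z)%E ->
  (\int[m]_z h z = \esum_(x in [set: X]) \int[m]_(z in p @^-1` [set x]) h z)%E.
Proof.
move=> /countable_injP[e einj] mp mh h0.
have ei : injective e by move=> x y; apply: einj; rewrite inE.
have mF B : measurable (p @^-1` B).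
  by rewrite -[_ @^-1` _]setTI; apply: mp => //; exact: measurable_discrete.
(* The injection [e] indexes the fibers by natural numbers; numbers outside its range index empty
   fibers, which contribute zero. *)
rewrite (_ : [set: S] = \bigcup_n (p @^-1` (e @^-1` [set n]))); last first.
  by apply/esym; rewrite -subTset => z _; exists (e (p z)).
rewrite ge0_integral_bigcup//; [|exact: measurable_funTS|]; last first.
  by move=> i j _ _ [z [/= <- <-]].
rewrite nneseries_esumT; last by move=> n; exact: integral_ge0.
rewrite [RHS](_ : _ = \esum_(n in e @` setT)
   \int[m]_(z in p @^-1` (e @^-1` [set n])) h z)%E; last first.
  rewrite esum_image; last by move=> x y _ _ /ei.
  apply: eq_esum => x _; congr (integral _ _ _).
  by apply/seteqP; split => z /=; [move=> ->|move/ei].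
rewrite [in RHS]esum_mkcond; apply: eq_esum => n _.
case: ifPn => // /negP nn.
rewrite (_ : _ @^-1` _ = set0) ?integral_set0//.
apply/seteqP; split=> // z /= ez; apply: nn; rewrite inE /=.
by exists (p z).
Qed.

Lemma integral_discrete {R : realType} {X : pdiscreteTopologicalType}
    (m : {measure set Borel X -> \bar R}) (h : X -> \bar R) :
  countable [set: X] -> (forall z, 0 <= h z)%E ->
  (\int[m]_z h z = \esum_(x in [set: X]) (m [set x] * h x))%E.
Proof.
move=> cX h0; rewrite (integral_fibers m id)//; last first.
  exact: measurable_fun_discrete.
apply: eq_esum => x _; rewrite preimage_id muleC.
rewrite -(integral_cst m); last exact: measurable_discrete.
by apply: eq_integral => y; rewrite inE => ->.
Qed.

(** * Weak compactness and test functions *)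

(** Otherwise every point of [G] lies in a basic ball whose preimage is not in [F]; finitely many
    such balls cover [G], so one of the preimages is in [F] after all. *)
Lemma weak_compact_ultra {R : realType} {X U : ptopologicalType}
    (G : set (probability (Borel X * Borel U)%type R)) (F : set_system nat)
    (nu_ : nat -> probability (Borel X * Borel U)%type R) :
  UltraFilter F -> weak_compact G -> (forall n, G (nu_ n)) ->
  exists2 nu, G nu & forall g : X * U -> R, bounded_continuous g ->
    fine (\int[nu_ n]_z (g z)%:E) @[n --> F] --> fine (\int[nu]_z (g z)%:E)%E.
Proof.
move=> FU cG Gn.
pose J (nu : probability (Borel X * Borel U)%type R) (g : X * U -> R) :=
  fine (\int[nu]_z (g z)%:E)%E.
pose ball i := [set nu | [/\ bounded_continuous i.1.2, 0 < i.2 &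
  `|J nu i.1.2 - J i.1.1 i.1.2| < i.2] ].
(* Balls whose preimage is in [F] are replaced by the empty set, so the cover can be indexed by all
   triples of centre, test function and radius. *)
pose O (i : probability (Borel X * Borel U)%type R * (X * U -> R) * R) :=
  [set nu | ball i nu /\ ~ F [set n | ball i (nu_ n)] ].
apply: contrapT => /forall2NP nG.
have [i||s sG] := cG _ O.
- move=> nu [[bg e0 nui] nF]; exists [:: i.1.2].
  (* The slack that [nu] leaves inside the ball, for the triangle inequality. *)
  exists (i.2 - `|J nu i.1.2 - J i.1.1 i.1.2|).
  split; [by move=> _ [<-|//] | split; first by rewrite subr_gt0].
  move=> nu' /(_ _ (or_introl erefl)) nu'nu; split=> //; split => //.
  rewrite -(subrKA (J nu i.1.2)) (le_lt_trans (ler_normD _ _))//.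
  by rewrite -ltrBrDr.
- move=> nu Gnu; have [//|ng] := nG nu.
  apply: contrapT => nO; apply: ng => g bg; apply/cvgrPdist_lt => e e0.
  apply: contrapT => nF; apply: nO; exists ((nu, g), e); split.
    by split => //=; rewrite subrr normr0.
  move=> Fb; apply: nF; apply: filterS Fb => n [_ _ /=].
  by rewrite distrC.
have [|i Fi] := @ultra_bigcup _ _ F (fun i => [set n | O i (nu_ n)]) s FU.
  by apply: filterS filterT => n _; exact: sG (Gn n).
have [n [_]] := filter_ex Fi; apply.
by apply: filterS Fi => m [].
Qed.

Lemma bounded_continuous_fiber {R : realType} {X : pdiscreteTopologicalType}
    {U : ptopologicalType} (x : X) (g : U -> R) :
  bounded_continuous g ->
  bounded_continuous (fun z : X * U => \1_[set x] z.1 * g z.2).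
Proof.
move=> [[M gM] cg]; split.
  exists M => z; rewrite normrM (le_trans _ (gM z.2))// ler_piMl//.
  by rewrite indicE; case: (_ \in _); rewrite ?normr1 ?normr0.
move=> z; apply: (@cvgM _ _ (nbhs z)).
  by apply: cvg_comp; [exact: cvg_fst|exact: discrete_continuous].
by apply: cvg_comp; [exact: cvg_snd|exact: cg].
Qed.

Lemma integral_singleton {R : realType} {X : pdiscreteTopologicalType}
    (m : {measure set (Borel X) -> \bar R}) (x : X) (c : X -> \bar R) :
  (\int[m]_y ((\1_[set x] y)%:E * c y) = m [set x] * c x)%E.
Proof.
rewrite muleC -(integral_cst m); last exact: measurable_discrete.
rewrite [RHS]integral_mkcond; apply: eq_integral => y _.
rewrite patchE indicE; case: ifPn => [|_]; last by rewrite mul0e.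
by rewrite inE => ->; rewrite mul1e.
Qed.

Lemma bounded_integrable {R : realType} {d} {S : measurableType d}
    (m : {measure set S -> \bar R}) (g : S -> R) :
  (m setT < +oo)%E -> measurable_fun setT g ->
  (exists M, forall z, `|g z| <= M) -> m.-integrable setT (EFin \o g).
Proof.
move=> mT mg [M gM]; apply: measurable_bounded_integrable => //.
exists M; split; first exact: num_real.
by move=> N MN z _; exact: le_trans (gM z) (ltW MN).
Qed.

(** * Young convergence, state by state *)

Section Young.
Context {R : realType} {X : pdiscreteTopologicalType} {U : ptopologicalType}.
Implicit Types (gamma : Policy R X U) (g : U -> R).

Lemma policy_integrable gamma x (g : Borel U -> R) :
  @bounded_continuous R U g -> measurable_fun setT g ->
  (gamma x).-integrable setT (EFin \o g).
Proof.
by move=> [bg _] mg; apply: bounded_integrable; rewrite // prob_kernel ltry.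
Qed.

(** With [g] localised at [x] as test function, the Young integral is [mu [set x]] times the
    integral against [gamma_n n x]; the positive mass can be divided out. *)
Lemma young_cvg_fiber (mu : probability (Borel X) R)
    (gamma_n : nat -> Policy R X U) gamma (x : X) (g : Borel U -> R) :
  (0 < mu [set x])%E -> young_cvg mu gamma_n gamma ->
  @bounded_continuous R U g -> measurable_fun setT g ->
  fine (\int[gamma_n n x]_u (g u)%:E)%E @[n --> \oo] -->
    fine (\int[gamma x]_u (g u)%:E)%E.
Proof.
move=> mux Y bg mg.
have mufin : (mu [set x] \is a fin_num)%E.
  by apply: fin_num_measure; exact: measurable_discrete.
have fiberE (d : Policy R X U) :
    (\int[mu]_y \int[d y]_u (\1_[set x] y * g u)%:E =
     (fine (mu [set x]) * fine (\int[d x]_u (g u)%:E))%:E)%E.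
  rewrite EFinM !fineK//; last first.
    exact: integrable_fin_num (policy_integrable _ _ _ bg mg).
  rewrite -(integral_singleton mu x (fun y => \int[d y]_u (g u)%:E)%E).
  apply: eq_integral => y _; under eq_integral do rewrite EFinM.
  by rewrite integralZl//; exact: policy_integrable bg mg.
have := Y _ (bounded_continuous_fiber x g bg).
rewrite fiberE; under eq_cvg do rewrite fiberE.
move=> /fine_cvgP[_] /=.
have m0 : fine (mu [set x]) != 0.
  by rewrite gt_eqF// fine_gt0// mux/= ltey_eq mufin.
have /[apply] := @cvgMl_tmp _ _ _ _ _ (fine (mu [set x]))^-1.
by rewrite mulKf//; apply: cvg_trans; apply: near_eq_cvg; apply: nearW => n /=;
  rewrite mulKf.
Qed.
End Young.

(** * Construction of occupation measures *)

Section NormedMeasure.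
Context {R : realType} {d} {S : measurableType d}.
Variables (m : {measure set S -> \bar R}) (m1 : m setT = 1%E).

(** The proof of total mass one is an argument, so that a probability structure can be attached to
    this alias of [m]. *)
Definition normed_measure of m setT = 1%E : set S -> \bar R := m.

HB.instance Definition _ := Measure.on (normed_measure m1).
HB.instance Definition _ :=
  Measure_isProbability.Build _ _ _ (normed_measure m1) m1.

Lemma probability_of_measure : exists P : probability S R, forall A, P A = m A.
Proof. by exists (normed_measure m1). Qed.

End NormedMeasure.

Section Occupation.
Context {R : realType} {X : pdiscreteTopologicalType} {U : ptopologicalType}.
Variable gamma : Policy R X U.

(** The law of [(x, u)] with [u] drawn from [gamma x]; the [unit] factor is the source of the first
    kernel in the composition. *)
Definition fiber_kernel (z : unit * Borel X) :
    {measure set (Borel X * Borel U)%type -> \bar R} :=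
  measure_function_pushforward__canonical__measure_function_Measure (gamma z.2)
    (pair1_measurable z.2).

Let measurable_fiber_kernel B : measurable B ->
  measurable_fun setT (fiber_kernel ^~ B).
Proof.
move=> mB.
apply: (measurableT_comp (f := fun x => fiber_kernel (tt, x) B) (g := snd)).
  exact: measurable_fun_discrete.
exact: measurable_snd.
Qed.

HB.instance Definition _ :=
  isKernel.Build _ _ _ _ _ fiber_kernel measurable_fiber_kernel.

Let fiber_kernelT z : fiber_kernel z setT = 1%E.
Proof. by rewrite /= /pushforward preimage_setT prob_kernel. Qed.

HB.instance Definition _ :=
  Kernel_isProbability.Build _ _ _ _ _ fiber_kernel fiber_kernelT.

(* The state distribution is fed to the kernel composition as a constant kernel
   out of [unit]. *)
Lemma occupation_measure (pi : probability (Borel X) R) :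
  exists nu : probability (Borel X * Borel U)%type R,
    forall h : Borel X * Borel U -> \bar R,
      measurable_fun setT h -> (forall z, 0 <= h z)%E ->
      (\int[nu]_z h z = \int[pi]_x \int[gamma x]_u h (x, u))%E.
Proof.
pose l := kprobability
  (measurable_cst (pi : pprobability (Borel X) R) (D := [set: unit])).
have integralE (h : Borel X * Borel U -> \bar R) :
    measurable_fun setT h -> (forall z, 0 <= h z)%E ->
    (\int[mkcomp l fiber_kernel tt]_z h z =
     \int[pi]_x \int[gamma x]_u h (x, u))%E.
  move=> mh h0; rewrite (integral_kcomp l fiber_kernel tt h0 mh).
  by apply: eq_integral => x _; rewrite ge0_integral_pushforward.
have [|nu nuE] := probability_of_measure (mkcomp l fiber_kernel tt).
  rewrite /mkcomp/= /kcomp.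
  under eq_integral do rewrite fiber_kernelT.
  by rewrite integral_cst// mul1e; exact: (probability_setT pi).
exists nu => h mh h0; rewrite -integralE//.
by apply: eq_measure_integral => A _ _; exact: nuE.
Qed.

End Occupation.

(** * Transition probabilities as real test functions of the action *)

Section Transition.
Context {R : realType} {X : pdiscreteTopologicalType} {U : ptopologicalType}.
Variable T : TKernel R X U.
Implicit Types (A : set (Borel X)) (gamma : Policy R X U).

Definition transition A (x : X) (u : U) : R := fine (T (x, u) A).

Lemma transition_fin_num z A : (T z A \is a fin_num)%E.
Proof.
rewrite ge0_fin_numE//; apply: (@le_lt_trans _ _ (T z setT)).
  by rewrite le_measure ?inE//; exact: measurable_discrete.
by rewrite prob_kernel ltry.
Qed.

Lemma transitionE A x u : T (x, u) A = (transition A x u)%:E.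
Proof. by rewrite fineK// transition_fin_num. Qed.

Lemma transition_ge0 A x u : 0 <= transition A x u.
Proof. exact: fine_ge0. Qed.

Lemma transition_bounded A x : exists M, forall u, `|transition A x u| <= M.
Proof.
exists 1 => u; rewrite ger0_norm ?transition_ge0// -lee_fin -transitionE.
apply: (@le_trans _ _ (T (x, u) setT)); last by rewrite prob_kernel.
by rewrite le_measure ?inE//; exact: measurable_discrete.
Qed.

Lemma measurable_transition A x :
  measurable_fun setT (transition A x : Borel U -> R).
Proof.
apply/measurable_EFinP; apply: (eq_measurable_fun (fun u => T (x, u) A)).
  by move=> u _; rewrite transitionE.
apply: (measurableT_comp (f := T ^~ A)); last exact: pair1_measurable.
by apply: measurable_kernel; exact: measurable_discrete.
Qed.

(** On a discrete space the indicator of any [A] is bounded and continuous, so continuity in the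
    action can be tested on it. *)
Lemma kernel_continuous_transition A x :
  kernel_continuous_in_action T -> @bounded_continuous R U (transition A x).
Proof.
move=> Tc; split; first exact: transition_bounded.
have /(Tc x) : bounded_continuous (\1_A : X -> R).
  split; last exact: discrete_continuous.
  by exists 1 => y; rewrite indicE; case: (_ \in _); rewrite ?normr1 ?normr0.
suff -> : transition A x = fun u => fine (\int[T (x, u)]_y (\1_A y)%:E)%E by [].
apply/funext => u; rewrite /transition integral_indic ?setIT//.
exact: measurable_discrete.
Qed.

Lemma integral_transition gamma A x :
  (\int[gamma x]_u T (x, u) A = \int[gamma x]_u (transition A x u)%:E)%E.
Proof. by apply: eq_integral => u _; rewrite transitionE. Qed.

Lemma integral_transition_fin_num gamma A x :
  (\int[gamma x]_u (transition A x u)%:E \is a fin_num)%E.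
Proof.
apply: integrable_fin_num => //; apply: bounded_integrable.
- by rewrite prob_kernel ltry.
- exact: measurable_transition.
- exact: transition_bounded.
Qed.

Lemma invariant_integral gamma (pi : probability (Borel X) R) A :
  countable [set: X] -> Defs.invariant T gamma pi ->
  (pi A = \int[pi]_x \int[gamma x]_u T (x, u) A)%E.
Proof.
move=> cX ->; last exact: measurable_discrete.
by rewrite integral_discrete// => x; exact: integral_ge0.
Qed.

End Transition.

Lemma probability_discrete_fin_num {R : realType} {X : pdiscreteTopologicalType}
  (pi : probability (Borel X) R) (A : set (Borel X)) : (pi A \is a fin_num)%E.
Proof. by apply: fin_num_measure; exact: measurable_discrete. Qed.

(** * Cluster points of the occupation measures *)

Section OccupationLimit.
Context {R : realType} {X : pdiscreteTopologicalType} {U : ptopologicalType}.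
Variable T : TKernel R X U.
Hypothesis cX : countable [set: X].

(** Both sides of the occupation identity reduce to the mass of the state set under [pi]: one by
    invariance, the other because each [gamma x] has total mass one. *)
Lemma occupation_set_invariant (gamma : Policy R X U) (pi : probability (Borel X) R)
    (nu : probability (Borel X * Borel U)%type R) :
  Defs.invariant T gamma pi ->
  (forall h : Borel X * Borel U -> \bar R,
      measurable_fun setT h -> (forall z, 0 <= h z)%E ->
      (\int[nu]_z h z = \int[pi]_x \int[gamma x]_u h (x, u))%E) ->
  occupation_set T nu.
Proof.
move=> piT nuE A mA.
rewrite nuE//; last by apply: measurable_kernel.
rewrite -(invariant_integral _ _ _ _ cX piT).
have mAT : measurable (A `*` [set: Borel U]) by exact: measurableX.
rewrite -[A `*` _](setIT _) -(integral_indic nu measurableT mAT).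
rewrite nuE//; last by apply/measurable_EFinP; exact: measurable_indic.
rewrite -[in RHS](setIT A) -(integral_indic pi measurableT mA).
apply: eq_integral => x _.
rewrite (eq_integral (cst (\1_A x)%:E)); last first.
  by move=> u _; rewrite !indicE in_setX in_setT andbT.
by rewrite integral_cst// prob_kernel mule1.
Qed.

(** The test functions are nonnegative because the integral formula for occupation measures is
    stated for such integrands; [weak_cvg_nonneg] passes to all signs. *)
Lemma occupation_cluster (F : set_system nat) (gamma_ : nat -> Policy R X U)
    (gamma : Policy R X U) (pi_ : nat -> probability (Borel X) R) :
  UltraFilter F -> \oo `<=` F ->
  weak_compact (occupation_set T) -> kernel_continuous_in_action T ->
  (forall n, Defs.invariant T (gamma_ n) (pi_ n)) ->
  (forall x (g : Borel U -> R), @bounded_continuous R U g ->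
     measurable_fun setT g ->
     fine (\int[gamma_ n x]_u (g u)%:E)%E @[n --> \oo] -->
       fine (\int[gamma x]_u (g u)%:E)%E) ->
  exists pi : probability (Borel X) R, Defs.invariant T gamma pi /\
    forall f : X -> R, bounded_continuous f -> (forall x, 0 <= f x) ->
      fine (\int[pi_ n]_x (f x)%:E) @[n --> F] --> fine (\int[pi]_x (f x)%:E)%E.
Proof.
move=> FU ooF cT Tc piT Y.
have [nu_ nuE] := choice (fun n => occupation_measure (gamma_ n) (pi_ n)).
have nuT n := occupation_set_invariant _ _ _ (piT n) (nuE n).
have [nu nuG nu_cvg] := weak_compact_ultra _ _ _ FU cT nuT.
have [pi piE] : exists pi : probability (Borel X) R,
    forall A, pi A = nu (A `*` [set: Borel U]).
  have [|pi piE] := probability_of_measure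
    (measure_function_pushforward__canonical__measure_function_Measure nu
       measurable_fst).
    by rewrite /= /pushforward preimage_setT probability_setT.
  exists pi => A; rewrite piE/= /pushforward; congr (nu _).
  by apply/seteqP; split => z //= [].
have integral_fst (f : X -> R) : (forall x, 0 <= f x) ->
    (\int[nu]_z (f z.1)%:E = \int[pi]_x (f x)%:E)%E.
  move=> f0.
  rewrite (eq_measure_integral
    (measure_function_pushforward__canonical__measure_function_Measure nu
       measurable_fst)); last first.
    move=> A _ _; rewrite /= /pushforward; apply: etrans (piE A) _; congr (nu _).
    by apply/seteqP; split => z //= [].
  rewrite ge0_integral_pushforward//; first exact: measurable_fun_discrete.
  by move=> x _; rewrite lee_fin.
have integral_fst_ n (f : X -> R) : (forall x, 0 <= f x) ->
    (\int[nu_ n]_z (f z.1)%:E = \int[pi_ n]_x (f x)%:E)%E.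
  move=> f0; rewrite nuE//.
  - apply: eq_integral => x _.
    apply: etrans (integral_cst (gamma_ n x) measurableT (f x)%:E) _.
    by rewrite prob_kernel mule1.
  - apply/measurable_EFinP/(measurableT_comp (f := f : Borel X -> R)) => //.
    exact: measurable_fun_discrete.
  - by move=> z; rewrite lee_fin.
have pi_cvg (f : X -> R) : bounded_continuous f -> (forall x, 0 <= f x) ->
    fine (\int[pi_ n]_x (f x)%:E) @[n --> F] --> fine (\int[pi]_x (f x)%:E)%E.
  move=> [[M fM] cf] f0; rewrite -integral_fst//.
  under eq_cvg do rewrite -integral_fst_//.
  apply: (nu_cvg (fun z => f z.1)); split; first by exists M.
  by move=> z; apply: cvg_comp; [exact: cvg_fst|exact: cf].
exists pi; split; last exact: pi_cvg.
(* The key identity: on each fiber, [nu] integrates continuous functions of the action like the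
   measure built from [pi] and [gamma]. *)
have fiberE x (g : U -> R) : @bounded_continuous R U g ->
    measurable_fun setT (g : Borel U -> R) -> (forall u, 0 <= g u) ->
    (\int[nu]_z (\1_[set x] z.1 * g z.2)%:E =
       pi [set x] * \int[gamma x]_u (g u)%:E)%E.
  move=> bg mg g0.
  have g_int (d : Policy R X U) : (\int[d x]_u (g u)%:E \is a fin_num)%E.
    by apply: integrable_fin_num => //; exact: policy_integrable.
  have mG : measurable_fun setT
      (fun z : Borel X * Borel U => \1_[set x] z.1 * g z.2).
    apply: measurable_funM; last exact: measurableT_comp.
    apply: (measurableT_comp (f := \1_[set x] : Borel X -> R)) => //.
    exact: measurable_fun_discrete.
  have G0 z : 0 <= \1_[set x] z.1 * g z.2 by rewrite mulr_ge0.
  have bG := bounded_continuous_fiber x g bg.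
  have nu_fin : (\int[nu]_z (\1_[set x] z.1 * g z.2)%:E \is a fin_num)%E.
    apply: integrable_fin_num => //; apply: bounded_integrable => //.
      exact: le_lt_trans (probability_le1 nu measurableT) (ltry _).
    by case: bG.
  have nu_fiberE n : (\int[nu_ n]_z (\1_[set x] z.1 * g z.2)%:E =
      pi_ n [set x] * \int[gamma_ n x]_u (g u)%:E)%E.
    rewrite nuE; last 2 first.
    - by apply/measurable_EFinP.
    - by move=> z; rewrite lee_fin.
    rewrite -(integral_singleton _ x (fun y => \int[gamma_ n y]_u (g u)%:E)%E).
    apply: eq_integral => y _; under eq_integral do rewrite EFinM/=.
    by rewrite integralZl//; exact: policy_integrable.
  have pix_cvg : fine (pi_ n [set x]) @[n --> F] --> fine (pi [set x]).
    have piX (p : probability (Borel X) R) :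
        p [set x] = (\int[p]_y (\1_[set x] y)%:E)%E.
      by rewrite integral_indic ?setIT//; exact: measurable_discrete.
    rewrite piX; under eq_cvg do rewrite piX.
    apply: pi_cvg => //; split; last exact: discrete_continuous.
    exists 1 => y; rewrite indicE.
    by case: (_ \in _); rewrite ?normr1 ?normr0.
  have := nu_cvg _ bG.
  under eq_cvg do rewrite nu_fiberE fineM ?probability_discrete_fin_num//.
  have gF := cvg_trans (cvg_app _ ooF) (Y x g bg mg).
  (* The same real sequence tends to the integral under [nu] and to the product of the limits of its
     two factors. *)
  move=> nuF; have fE := cvg_unique (@norm_hausdorff _ _) nuF (cvgM pix_cvg gF).
  rewrite -[LHS]fineK// fE// EFinM !fineK//.
  exact: probability_discrete_fin_num.
move=> A mA; rewrite piE.
(* The occupation identity is cut along the fibers of the state projection, where [fiberE] applies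
   with the transition probability as test function. *)
rewrite (nuG _ mA) (integral_fibers _ fst)//; last exact: measurable_kernel.
apply: eq_esum => x _; rewrite integral_transition -fiberE; last 3 first.
- exact: kernel_continuous_transition.
- exact: measurable_transition.
- exact: transition_ge0.
rewrite integral_mkcond; apply: eq_integral => -[y u] _.
rewrite patchE indicE /= (_ : (_, _) \in _ = (y \in [set x])); last first.
  by apply/idP/idP; rewrite !inE.
case: ifPn => [/set_mem ->|_]; last by rewrite mul0r.
by rewrite mul1r transitionE.
Qed.
End OccupationLimit.

(** * Finite state spaces *)

(** Compactness gives a cluster point, and an ultrafilter converges to each of its cluster
    points. *)
Lemma ultra_compact_cvg {S : topologicalType} {I : Type} (F : set_system I)
    (K : set S) (u : I -> S) :
  UltraFilter F -> compact K -> (forall i, K (u i)) ->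
  exists2 p, K p & u @ F --> p.
Proof.
move=> FU cK Ku; have [|p [Kp clp]] := cK (u @ F) _ _.
  by apply: (filterE (F := F)) => i; exact: Ku.
exists p => // A Ap.
have [//|FnA] := in_ultra_setVsetC (u @^-1` A) FU.
by have [q []] := clp (~` A) A FnA Ap.
Qed.

Section FiniteStates.
Context {R : realType} {X : pdiscreteTopologicalType} {U : ptopologicalType}.
Variable T : TKernel R X U.
Variable s : seq X.
Hypotheses (us : uniq s) (sT : [set: X] = [set` s]).

Lemma esum_seq (a : X -> \bar R) : (forall x, 0 <= a x)%E ->
  (\esum_(x in [set: X]) a x = \sum_(x <- s) a x)%E.
Proof.
move=> a0; rewrite sT esum_fset//; last exact: finite_seq.
by rewrite -fsbig_seq.
Qed.

Lemma integral_seq (pi : probability (Borel X) R) (f : X -> R) :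
  (forall x, 0 <= f x) ->
  (\int[pi]_x (f x)%:E = (\sum_(x <- s) fine (pi [set x]) * f x)%:E)%E.
Proof.
move=> f0; rewrite integral_discrete//; last first.
  by rewrite sT; apply: finite_set_countable; exact: finite_seq.
rewrite esum_seq; last by move=> x; rewrite mule_ge0 ?lee_fin.
rewrite -sumEFin; apply: eq_bigr => x _.
by rewrite EFinM fineK// probability_discrete_fin_num.
Qed.

Lemma probability_seq (pi : probability (Borel X) R) (A : set X) :
  fine (pi A) = \sum_(x <- s) fine (pi [set x]) * \1_A x.
Proof.
transitivity (fine (\int[pi]_x (\1_A x)%:E)%E); last by rewrite integral_seq.
by rewrite integral_indic ?setIT//; exact: measurable_discrete.
Qed.

Lemma probability_of_weights (p : X -> R) :
  (forall x, 0 <= p x) -> \sum_(x <- s) p x = 1 ->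
  exists pi : probability (Borel X) R,
    forall A, fine (pi A) = \sum_(x <- s) p x * \1_A x.
Proof.
move=> p0 p1.
(* The default [point] only occurs for [k] beyond the list, where the sum of measures has already
   stopped. *)
pose w k : {measure set (Borel X) -> \bar R} :=
  mscale (NngNum (p0 (nth point s k))) (dirac (nth point s k : Borel X)).
have wE A : msum w (size s) A = (\sum_(x <- s) p x * \1_A x)%:E.
  rewrite /msum (big_nth point) big_mkord -sumEFin; apply: eq_bigr => k _.
  by rewrite /w /= /mscale /= diracE EFinM.
have [|pi piE] := probability_of_measure (msum w (size s)).
  apply: etrans (wE _) _; rewrite -p1; congr _%:E; apply: eq_bigr => x _.
  by rewrite indicE in_setT mulr1.
by exists pi => A; rewrite piE; exact: (congr1 (@fine R) (wE A)).
Qed.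

(** The point masses have limits in the unit interval, and finite sums commute with these limits, so
    total mass and invariance survive. *)
Lemma finite_cluster (F : set_system nat) (gamma_ : nat -> Policy R X U)
    (gamma : Policy R X U) (pi_ : nat -> probability (Borel X) R) :
  UltraFilter F -> \oo `<=` F ->
  (forall n, Defs.invariant T (gamma_ n) (pi_ n)) ->
  (forall x A, fine (\int[gamma_ n x]_u (transition T A x u)%:E)%E @[n --> \oo] -->
       fine (\int[gamma x]_u (transition T A x u)%:E)%E) ->
  exists pi : probability (Borel X) R, Defs.invariant T gamma pi /\
    forall f : X -> R, bounded_continuous f -> (forall x, 0 <= f x) ->
      fine (\int[pi_ n]_x (f x)%:E) @[n --> F] --> fine (\int[pi]_x (f x)%:E)%E.
Proof.
move=> FU ooF piT Y.
have /choice[p pP] x : exists r : R, 0 <= r /\ fine (pi_ n [set x]) @[n --> F] --> r.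
  have [n|r] := ultra_compact_cvg F _ (fun n => fine (pi_ n [set x])) FU
    (@segment_compact R 0 1).
    rewrite /= in_itv/= fine_ge0//= -lee_fin fineK.
      by apply: probability_le1; exact: measurable_discrete.
    exact: probability_discrete_fin_num.
  by rewrite /= in_itv/= => /andP[r0 _]; exists r.
have sum_cvg (a : nat -> X -> R) b : (forall x, a n x @[n --> F] --> b x) ->
    \sum_(x <- s) fine (pi_ n [set x]) * a n x @[n --> F] -->
    \sum_(x <- s) p x * b x.
  move=> ab; apply: cvg_big => [|x _]; first exact: add_continuous.
  by apply: cvgM => //; exact: (pP x).2.
have sum_cvg_cst (b : X -> R) :
    \sum_(x <- s) fine (pi_ n [set x]) * b x @[n --> F] -->
    \sum_(x <- s) p x * b x.
  by apply: sum_cvg => x; exact: cvg_cst.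
have [||pi piE] := probability_of_weights p.
- by move=> x; have [] := pP x.
(* Every [pi_ n] has total mass one, hence so do the limit weights. *)
- have := sum_cvg_cst \1_setT.
  under eq_cvg do rewrite -probability_seq probability_setT.
  move=> p_cvg.
  have -> := cvg_unique (@norm_hausdorff _ _) (cvg_cst (1 : R)) p_cvg.
  by apply: eq_bigr => x _; rewrite indicE in_setT mulr1.
have pi_cvg A : fine (pi_ n A) @[n --> F] --> fine (pi A).
  rewrite piE; under eq_cvg do rewrite probability_seq.
  exact: sum_cvg_cst.
have pE x : p x = fine (pi [set x]).
  exact: (cvg_unique (@norm_hausdorff _ _) (pP x).2 (pi_cvg [set x])).
exists pi; split; last first.
  move=> f _ f0; rewrite integral_seq//=.
  under eq_cvg do rewrite integral_seq//=.
  under eq_bigr do rewrite -pE.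
  exact: sum_cvg_cst.
have invE (d : Policy R X U) (q : probability (Borel X) R) A :
    (\esum_(x in [set: Borel X]) (q [set x] * \int[d x]_u T (x, u) A) =
     (\sum_(x <- s) fine (q [set x]) *
       fine (\int[d x]_u (transition T A x u)%:E))%:E)%E.
  rewrite esum_seq; last by move=> x; rewrite mule_ge0// integral_ge0.
  rewrite -sumEFin; apply: eq_bigr => x _; rewrite integral_transition EFinM.
  by rewrite !fineK ?integral_transition_fin_num ?probability_discrete_fin_num.
move=> A mA; rewrite invE -[LHS]fineK ?probability_discrete_fin_num//.
congr _%:E; under eq_bigr do rewrite -pE.
(* Invariance of [pi_ n] gives a second expression for its mass on [A], whose limit is the required
   sum. *)
apply: (cvg_unique (@norm_hausdorff _ _) (pi_cvg A)); rewrite /=.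
under eq_cvg do rewrite (piT _ _ mA) invE /=.
by apply: sum_cvg => x; exact: cvg_trans (cvg_app _ ooF) (Y x A).
Qed.

End FiniteStates.

(** * From ultrafilter limits to weak convergence *)

Section WeakConvergence.
Context {R : realType} {X : pdiscreteTopologicalType} {U : ptopologicalType}.
Variable T : TKernel R X U.

(** Adding the bound [M] makes [f] nonnegative and shifts its integral under every probability by
    the same constant. *)
Lemma weak_cvg_nonneg (pi_ : nat -> probability (Borel X) R)
    (pi : probability (Borel X) R) :
  (forall f : X -> R, bounded_continuous f -> (forall x, 0 <= f x) ->
     fine (\int[pi_ n]_x (f x)%:E) @[n --> \oo] --> fine (\int[pi]_x (f x)%:E)%E) ->
  weak_cvg pi_ pi.
Proof.
move=> pi_cvg f [[M fM] cf].
have f_int (q : probability (Borel X) R) : q.-integrable setT (EFin \o f).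
  apply: bounded_integrable.
  - exact: le_lt_trans (probability_le1 q measurableT) (ltry _).
  - exact: measurable_fun_discrete.
  - by exists M.
have fin (q : probability (Borel X) R) : (\int[q]_x (f x)%:E \is a fin_num)%E.
  exact: integrable_fin_num (f_int q).
have shift (q : probability (Borel X) R) :
    fine (\int[q]_x (f x + M)%:E)%E = fine (\int[q]_x (f x)%:E)%E + M.
  have qM : (\int[q]_x M%:E = M%:E)%E.
    apply: etrans (integral_cst q measurableT M%:E) _.
    by rewrite [X in (_ * X)%E](probability_setT q) mule1.
  under eq_integral do rewrite EFinD.
  rewrite integralD//; [|exact: f_int|exact: finite_measure_integrable_cst].
  by rewrite [X in fine (_ + X)%E]qM fineD// fin.
have bfM : bounded_continuous (fun x => f x + M).
  split; last exact: discrete_continuous.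
  by exists (M + `|M|) => x; rewrite (le_trans (ler_normD _ _))// lerD2r.
have fM0 x : 0 <= f x + M.
  by rewrite -lerBlDr sub0r; have := fM x; rewrite ler_norml => /andP[].
rewrite -(fineK (fin pi)); apply/fine_cvgP; split; first exact: nearW.
have unshift (q : probability (Borel X) R) :
    fine (\int[q]_x (f x)%:E)%E = fine (\int[q]_x (f x + M)%:E)%E - M.
  by rewrite shift addrK.
rewrite unshift; under eq_cvg do rewrite /= unshift.
by apply: cvgB (cvg_cst _); exact: pi_cvg.
Qed.

(** It suffices to converge along each ultrafilter finer than [\oo], and there uniqueness identifies
    the limit. *)
Lemma invariant_map_continuous_of_cluster (mu : probability (Borel X) R) :
  unique_invariant T ->
  (forall (gamma_ : nat -> Policy R X U) (gamma : Policy R X U)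
      (pi_ : nat -> probability (Borel X) R) (F : set_system nat),
    young_cvg mu gamma_ gamma -> UltraFilter F -> \oo `<=` F ->
    (forall n, Defs.invariant T (gamma_ n) (pi_ n)) ->
    exists pi : probability (Borel X) R, Defs.invariant T gamma pi /\
      forall f : X -> R, bounded_continuous f -> (forall x, 0 <= f x) ->
        fine (\int[pi_ n]_x (f x)%:E) @[n --> F] -->
          fine (\int[pi]_x (f x)%:E)%E) ->
  invariant_map_continuous T mu.
Proof.
move=> uT clu gamma_ gamma pi_ pi piT_ piT Y; apply: weak_cvg_nonneg => f bf f0.
apply: cvg_ultra => F FU ooF.
have [pi' [pi'T /(_ f bf f0)]] := clu _ _ _ _ Y FU ooF piT_.
(* [pi0] is the reference measure of the uniqueness hypothesis; [pi'] and [pi] are both compared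
   with it. *)
have [pi0 [_ pi0u]] := uT gamma.
congr (_ --> fine _); apply: eq_measure_integral => A mA _.
exact: etrans (pi0u _ pi'T A mA) (esym (pi0u _ piT A mA)).
Qed.

End WeakConvergence.

Theorem theorem4p2 :
  (* (i) finite state space, finite action space (discrete topologies) *)
  (forall (R : realType) (X U : pdiscreteTopologicalType)
          (T : TKernel R X U),
     finite_set [set: X] -> finite_set [set: U] ->
     unique_invariant T ->
     forall mu : probability (Borel X) R,
       (forall x : X, (0 < mu [set x])%E) ->
       invariant_map_continuous T mu)
  /\
  (* (ii) countable (discrete) state space, compact action space *)
  (forall (R : realType) (X : pdiscreteTopologicalType) (U : ptopologicalType)
          (T : TKernel R X U),
     countable [set: X] -> compact [set: U] ->
     unique_invariant T ->
     weak_compact (occupation_set T) ->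
     kernel_continuous_in_action T ->
     forall mu : probability (Borel X) R,
       (forall x : X, (0 < mu [set x])%E) ->
       invariant_map_continuous T mu).
Proof.
split=> [R X U T fX fU uT mu mu0|R X U T cX _ uT cT Tc mu mu0].
- have [s sT] := (finite_seqP _).1 fX.
  apply: invariant_map_continuous_of_cluster => // gamma_ gamma pi_ F Y FU ooF piT.
  (* The enumeration [s] may repeat states, which would count their masses twice. *)
  apply: (finite_cluster T (undup s)) FU ooF piT _; first exact: undup_uniq.
    by rewrite sT; apply/seteqP; split => x /=; rewrite mem_undup.
  move=> x A; apply: young_cvg_fiber Y _ (measurable_transition _ _ _) => //.
  (* Continuity in the action is automatic here because [U] is discrete. *)
  by split; [exact: transition_bounded|exact: discrete_continuous].
- apply: invariant_map_continuous_of_cluster => // gamma_ gamma pi_ F Y FU ooF piT.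
  apply: occupation_cluster FU ooF cT Tc piT _ => // x g bg mg.
  exact: young_cvg_fiber Y bg mg.
Qed.
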